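(* Let $(\mathcal{A},\mathcal{H},D;J)$ be a real spectral triple, possibly not fulfilling the first-order condition. (i) Let $A=\sum_j a_j\otimes b_j^{\mathrm{op}}\in\mathcal{A}\otimes\mathcal{A}^{\mathrm{op}}$ be normalized by the condition $\sum_j a_jb_j=1$. Then the operator $D'=D(\eta(A))$ is equal to the inner fluctuation of $D$ with respect to the algebra $\mathcal{A}\otimes\hat{\mathcal{A}}$ and the one-form $\eta(A\otimes\hat A)$, that is, $$D'=D+\sum_{i,j}a_i\hat a_j\,[D,b_i\hat b_j].$$ (ii) An inner fluctuation of an inner fluctuation of $D$ is still an inner fluctuation of $D$; more precisely, for normalized elements $A,A'$ of $\mathcal{A}\otimes\mathcal{A}^{\mathrm{op}}$ (normalized in the sense of (i)), $$\big(D(\eta(A))\big)(\eta(A'))=D(\eta(A'A)),$$ where the product $A'A$ is taken in the tensor product algebra $\mathcal{A}\otimes\mathcal{A}^{\mathrm{op}}$.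
   Context: Real spectral triple (first-order condition not assumed): a unital involutive algebra $\mathcal{A}$ represented by bounded operators on a Hilbert space $\mathcal{H}$, a self-adjoint operator $D$ with compact resolvent such that each $a\in\mathcal{A}$ preserves $\mathrm{Dom}(D)$ and $[D,a]$ is bounded, and an antilinear isometry $J$ of $\mathcal{H}$ onto itself with $J^2=\pm1$, $JDJ^{-1}=\epsilon D$ for some $\epsilon\in\{\pm1\}$, and $[a,JbJ^{-1}]=0$ for all $a,b\in\mathcal{A}$. The first-order condition would be $[[D,a],JbJ^{-1}]=0$ for all $a,b\in\mathcal{A}$. Notation: $\hat T=JTJ^{-1}$ for operators $T$ on $\mathcal{H}$, $\hat{\mathcal{A}}=J\mathcal{A}J^{-1}$; $\mathcal{A}\otimes\hat{\mathcal{A}}$ acts on $\mathcal{H}$ by $a\otimes\hat b\mapsto a\hat b$. $\mathcal{A}^{\mathrm{op}}$ is the opposite algebra, $x\mapsto x^{\mathrm{op}}$ the canonical anti-isomorphism. $\Omega^1(\mathcal{A})$ is the bimodule of universal one-forms, spanned by $a\,\delta(b)$, $\delta$ the universal derivation; for normalized $A=\sum_j a_j\otimes b_j^{\mathrm{op}}$, $\eta(A)=\sum_j a_j\delta(b_j)\in\Omega^1(\mathcal{A})$. Likewise $A\otimes\hat A=\sum_{i,j}a_i\hat a_j\otimes(b_i\hat b_j)^{\mathrm{op}}$ and $\eta(A\otimes\hat A)=\sum_{i,j}a_i\hat a_j\,\delta(b_i\hat b_j)$. The inner fluctuation of $D$ with respect to an algebra $\mathcal{B}$ acting on $\mathcal{H}$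 and a one-form $\sum_k x_k\delta(y_k)\in\Omega^1(\mathcal{B})$ is $D+\sum_k x_k[D,y_k]$. For an operator $T$ on $\mathcal{H}$ with domain $\mathrm{Dom}(D)$ (in particular $T=D$ or $T=D(\eta(A))$) and $\omega=\sum_j a_j\delta(b_j)\in\Omega^1(\mathcal{A})$, put $$T(\omega)=T+\sum_j a_j[T,b_j]+\sum_j\hat a_j[T,\hat b_j]+\sum_{j,k}\hat a_j\big[a_k[T,b_k],\hat b_j\big];$$ this depends only on $\omega$, not on its presentation. *)

(* Defs.v *)
From HB Require Import structures.
From mathcomp Require Import all_boot all_order all_algebra sesquilinear.
From mathcomp Require Import complex.
From mathcomp Require Import all_classical all_reals all_analysis.

Set Implicit Arguments.
Unset Strict Implicit.
Unset Printing Implicit Defensive.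

Import Order.TTheory GRing.Theory Num.Theory.
Import numFieldNormedType.Exports.
Local Open Scope classical_set_scope.
Local Open Scope ring_scope.
Local Open Scope quotient_scope.

(** * Algebras *)

HB.mixin Record hasStar (K : numClosedFieldType) A of GRing.Algebra K A := {
  star : A -> A;
  starK : involutive star;
  starD : {morph star : x y / x + y};
  starM : forall x y : A, star (x * y) = star y * star x;
  starZ : forall (k : K) (x : A), star (k *: x) = k^* *: star x
}.

#[short(type="starAlgType")]
HB.structure Definition StarAlg (K : numClosedFieldType) :=
  {A of GRing.Algebra K A & hasStar K A}.

Section Opposite.
Variables (K : comNzRingType) (A : algType K).

HB.instance Definition _ := GRing.Lmodule.copy A^c A.

Fact op_scalerAl (k : K) (x y : A^c) : k *: (x * y) = (k *: x : A^c) * y.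
Proof. exact: (scalerAr k (y : A) (x : A)). Qed.
HB.instance Definition _ := GRing.Lmodule_isLalgebra.Build K A^c op_scalerAl.
Fact op_scalerAr (k : K) (x y : A^c) : k *: (x * y) = x * (k *: y).
Proof. exact: (scalerAl k (y : A) (x : A)). Qed.
HB.instance Definition _ := GRing.Lalgebra_isAlgebra.Build K A^c op_scalerAr.

Definition toop (x : A) : A^c := x.
End Opposite.

(* The complex conjugate algebra: same ring, scalars acting through
   conjugation.  It plays the role of J A J^-1, since J (k a) J^-1 =
   k^* (J a J^-1) for an antilinear J. *)
Definition conj_alg (A : Type) : Type := A.

Section Conjugate.
Variables (K : numClosedFieldType) (A : algType K).

HB.instance Definition _ := GRing.NzRing.copy (conj_alg A) A.

Definition conj_scale (k : K) (x : conj_alg A) : conj_alg A := k^* *: (x : A).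
Fact conj_scalerA a b v : conj_scale a (conj_scale b v) = conj_scale (a * b) v.
Proof. by rewrite /conj_scale scalerA rmorphM. Qed.
Fact conj_scale1r : left_id 1 conj_scale.
Proof. by move=> v; rewrite /conj_scale rmorph1 scale1r. Qed.
Fact conj_scalerDr : right_distributive conj_scale +%R.
Proof. by move=> a u v; rewrite /conj_scale scalerDr. Qed.
Fact conj_scalerDl v : {morph conj_scale^~ v : a b / a + b}.
Proof. by move=> a b; rewrite /conj_scale rmorphD scalerDl. Qed.
HB.instance Definition _ := GRing.Zmodule_isLmodule.Build K (conj_alg A)
  conj_scalerA conj_scale1r conj_scalerDr conj_scalerDl.

Fact conj_scalerAl (k : K) (x y : conj_alg A) :
  k *: (x * y) = (k *: x : conj_alg A) * y.
Proof. exact: (@scalerAl K A). Qed.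
HB.instance Definition _ :=
  GRing.Lmodule_isLalgebra.Build K (conj_alg A) conj_scalerAl.
Fact conj_scalerAr (k : K) (x y : conj_alg A) :
  k *: (x * y) = x * (k *: y : conj_alg A).
Proof. exact: (@scalerAr K A). Qed.
HB.instance Definition _ :=
  GRing.Lalgebra_isAlgebra.Build K (conj_alg A) conj_scalerAr.

Definition tohat (x : A) : conj_alg A := x.
End Conjugate.

(** * Tensor products *)

Section Tensor.
Variables (K : comNzRingType) (U V : lmodType K).
Implicit Types (s t : seq (U * V)) (k : K).

(* A sequence of pairs stands for the formal sum of the corresponding pure
   tensors. *)
Inductive tensor_eq : seq (U * V) -> seq (U * V) -> Prop :=
| teq_refl s : tensor_eq s s
| teq_sym s t : tensor_eq s t -> tensor_eq t s
| teq_trans s t r : tensor_eq s t -> tensor_eq t r -> tensor_eq s r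
| teq_cat s s' t t' :
    tensor_eq s s' -> tensor_eq t t' -> tensor_eq (s ++ t) (s' ++ t')
| teq_catC s t : tensor_eq (s ++ t) (t ++ s)
| teq_zero v : tensor_eq [:: (0, v)] [::]
| teq_addl u u' v : tensor_eq [:: (u + u', v)] [:: (u, v); (u', v)]
| teq_addr u v v' : tensor_eq [:: (u, v + v')] [:: (u, v); (u, v')]
| teq_scale k u v : tensor_eq [:: (k *: u, v)] [:: (u, k *: v)].

Definition tensor_rel s t : bool := `[< tensor_eq s t >].

Fact tensor_rel_refl : reflexive tensor_rel.
Proof. by move=> s; apply/asboolP; exact: teq_refl. Qed.
Fact tensor_rel_sym : symmetric tensor_rel.
Proof. by move=> s t; apply/asboolP/asboolP => /teq_sym. Qed.
Fact tensor_rel_trans : transitive tensor_rel.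
Proof.
by move=> t s r /asboolP st /asboolP tr; apply/asboolP; exact: teq_trans st tr.
Qed.
Canonical tensor_equiv :=
  EquivRel tensor_rel tensor_rel_refl tensor_rel_sym tensor_rel_trans.

Definition tensor : Type := {eq_quot tensor_equiv}.
HB.instance Definition _ := Choice.on tensor.
HB.instance Definition _ := EqQuotient.on tensor.

Lemma tensor_pi s t : (\pi_tensor s = \pi_tensor t) <-> tensor_eq s t.
Proof. by split=> [/eqmodP/asboolP|st]; [|apply/eqmodP/asboolP]. Qed.

Lemma tensor_repr s : tensor_eq (repr (\pi_tensor s)) s.
Proof. by apply/tensor_pi; rewrite reprK. Qed.

Lemma tensorW (P : tensor -> Prop) :
  (forall s, P (\pi_tensor s)) -> forall x, P x.
Proof. by move=> Ps x; rewrite -[x]reprK. Qed.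

Definition tadd (x y : tensor) : tensor := \pi_tensor (repr x ++ repr y).
Definition topp (x : tensor) : tensor :=
  \pi_tensor [seq (- p.1, p.2) | p <- repr x].
Definition tscale k (x : tensor) : tensor :=
  \pi_tensor [seq (k *: p.1, p.2) | p <- repr x].

Definition pure (u : U) (v : V) : tensor := \pi_tensor [:: (u, v)].

Lemma tensor_eq_scale k s t : tensor_eq s t ->
  tensor_eq [seq (k *: p.1, p.2) | p <- s] [seq (k *: p.1, p.2) | p <- t].
Proof.
elim=> {s t} /=.
- by move=> s; exact: teq_refl.
- by move=> s t _; exact: teq_sym.
- by move=> s t r _ st _; exact: teq_trans.
- by move=> s s' t t' _ ss _ tt; rewrite !map_cat; exact: teq_cat.
- by move=> s t; rewrite !map_cat; exact: teq_catC.
- by move=> v; rewrite scaler0; exact: teq_zero.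
- by move=> u u' v; rewrite scalerDr; exact: teq_addl.
- by move=> u v v'; exact: teq_addr.
- by move=> c u v; rewrite scalerA mulrC -scalerA; exact: teq_scale.
Qed.

Lemma tadd_pi s t : tadd (\pi_tensor s) (\pi_tensor t) = \pi_tensor (s ++ t).
Proof. by apply/tensor_pi; apply: teq_cat; exact: tensor_repr. Qed.
Lemma tscale_pi k s :
  tscale k (\pi_tensor s) = \pi_tensor [seq (k *: p.1, p.2) | p <- s].
Proof. by apply/tensor_pi; apply: tensor_eq_scale; exact: tensor_repr. Qed.
Lemma toppE x : topp x = tscale (-1) x.
Proof.
by rewrite /topp /tscale; congr (\pi_tensor _); apply: eq_map => p; rewrite scaleN1r.
Qed.

Fact taddA : associative tadd.
Proof.
move=> x y z; elim/tensorW: x => x; elim/tensorW: y => y; elim/tensorW: z => z.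
by rewrite !tadd_pi catA. Qed.
Fact taddC : commutative tadd.
Proof.
move=> x y; elim/tensorW: x => x; elim/tensorW: y => y; rewrite !tadd_pi.
by apply/tensor_pi; exact: teq_catC.
Qed.
Fact tadd0 : left_id (\pi_tensor [::]) tadd.
Proof. by move=> x; elim/tensorW: x => x; rewrite tadd_pi. Qed.
Lemma tensor_eq_scaleDl a b s :
  tensor_eq [seq ((a + b) *: p.1, p.2) | p <- s]
    ([seq (a *: p.1, p.2) | p <- s] ++ [seq (b *: p.1, p.2) | p <- s]).
Proof.
elim: s => [|[u v] s IH] /=; first exact: teq_refl.
rewrite scalerDl.
apply: (@teq_trans _ ([:: (a *: u, v); (b *: u, v)] ++
   ([seq (a *: p.1, p.2) | p <- s] ++ [seq (b *: p.1, p.2) | p <- s]))).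
  by rewrite -cat1s; apply: teq_cat => //; exact: teq_addl.
rewrite /= -(cat1s (a *: u, v)) -[X in tensor_eq _ X](cat1s (a *: u, v)).
apply: teq_cat; first exact: teq_refl.
rewrite -cat1s -[(b *: u, v) :: map _ _]cat1s !catA.
by apply: teq_cat; [exact: teq_catC|exact: teq_refl].
Qed.
Lemma tensor_eq_scale0 s : tensor_eq [seq (0 *: p.1, p.2) | p <- s] [::].
Proof.
elim: s => [|[u v] s IH] /=; first exact: teq_refl.
rewrite scale0r -cat1s -[[::]]/([::] ++ [::]).
by apply: teq_cat => //; exact: teq_zero.
Qed.
Fact taddN : left_inverse (\pi_tensor [::]) topp tadd.
Proof.
move=> x; elim/tensorW: x => s; rewrite toppE tscale_pi tadd_pi; apply/tensor_pi.
apply: (teq_trans _ (tensor_eq_scale0 s)).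
rewrite -[0](addNr 1); apply: teq_sym.
have /= := tensor_eq_scaleDl (-1) 1 s.
by rewrite [X in _ ++ X](_ : _ = s)// -[RHS]map_id; apply: eq_map => -[u v]/=;
  rewrite scale1r.
Qed.
HB.instance Definition _ := GRing.isZmodule.Build tensor taddA taddC tadd0 taddN.

Fact tscaleA a b x : tscale a (tscale b x) = tscale (a * b) x.
Proof.
elim/tensorW: x => s; rewrite !tscale_pi -map_comp; congr (\pi_tensor _).
by apply: eq_map => p /=; rewrite scalerA.
Qed.
Fact tscale1 : left_id 1 tscale.
Proof.
move=> x; elim/tensorW: x => s; rewrite tscale_pi; congr (\pi_tensor _).
by rewrite -[RHS]map_id; apply: eq_map => -[u v]/=; rewrite scale1r.
Qed.
Fact tscaleDr : right_distributive tscale +%R.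
Proof.
move=> k; move=> x y; elim/tensorW: x => s; elim/tensorW: y => t.
by rewrite [_ + _]tadd_pi !tscale_pi [RHS]tadd_pi map_cat.
Qed.
Fact tscaleDl x : {morph tscale^~ x : a b / a + b}.
Proof.
move=> a b; elim/tensorW: x => s; rewrite !tscale_pi [RHS]tadd_pi.
by apply/tensor_pi; exact: tensor_eq_scaleDl.
Qed.
HB.instance Definition _ :=
  GRing.Zmodule_isLmodule.Build K tensor tscaleA tscale1 tscaleDr tscaleDl.

Lemma pi_sum s : \pi_tensor s = \sum_(p <- s) pure p.1 p.2.
Proof.
elim: s => [|[u v] s IH]; first by rewrite big_nil.
by rewrite big_cons -IH [RHS]tadd_pi.
Qed.

Definition balanced (W : zmodType) (f : U -> V -> W) :=
  [/\ forall u u' v, f (u + u') v = f u v + f u' v,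
      forall u v v', f u (v + v') = f u v + f u v' &
      forall k u v, f (k *: u) v = f u (k *: v)].

(* The map u ⊗ v |-> f u v; independence of the representative is
   [tlift_pi]. *)
Definition tlift (W : zmodType) (f : U -> V -> W) (x : tensor) : W :=
  \sum_(p <- repr x) f p.1 p.2.

Section Lift.
Variables (W : zmodType) (f : U -> V -> W).
Hypothesis bf : balanced f.

Lemma tlift_pi s : tlift f (\pi_tensor s) = \sum_(p <- s) f p.1 p.2.
Proof.
case: bf => fDl fDr fZ; rewrite /tlift; move: (tensor_repr s).
move: (repr _) => t; elim=> {s t} /=.
- by [].
- by move=> s t _ ->.
- by move=> s t r _ -> _ ->.
- by move=> s s' t t' _ ss _ tt; rewrite !big_cat /= ss tt.
- by move=> s t; rewrite !big_cat /= addrC.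
- move=> v; rewrite big_cons big_nil /= addr0; apply: (addrI (f 0 v)).
  by rewrite -fDl !addr0.
- by move=> u u' v; rewrite !big_cons !big_nil /= !addr0 fDl.
- by move=> u v v'; rewrite !big_cons !big_nil /= !addr0 fDr.
- by move=> k u v; rewrite !big_cons !big_nil /= !addr0 fZ.
Qed.

Lemma tlift_pure u v : tlift f (pure u v) = f u v.
Proof. by rewrite tlift_pi big_seq1. Qed.

Lemma tliftD x y : tlift f (x + y) = tlift f x + tlift f y.
Proof.
elim/tensorW: x => s; elim/tensorW: y => t.
by rewrite (tadd_pi s t : _ + _ = _) !tlift_pi big_cat.
Qed.

Lemma tlift0 : tlift f 0 = 0.
Proof. by apply: (addrI (tlift f 0)); rewrite -tliftD !addr0. Qed.

Lemma tlift_sum I (r : seq I) (F : I -> tensor) :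
  tlift f (\sum_(i <- r) F i) = \sum_(i <- r) tlift f (F i).
Proof. exact: (big_morph _ tliftD tlift0). Qed.

Lemma tliftB x y : tlift f (x - y) = tlift f x - tlift f y.
Proof. by apply/eqP; rewrite eq_sym subr_eq -tliftD subrK. Qed.
End Lift.

Lemma pureDl u u' v : pure (u + u') v = pure u v + pure u' v.
Proof. by rewrite [RHS]tadd_pi; apply/tensor_pi; exact: teq_addl. Qed.
Lemma pureDr u v v' : pure u (v + v') = pure u v + pure u v'.
Proof. by rewrite [RHS]tadd_pi; apply/tensor_pi; exact: teq_addr. Qed.
Lemma pureZl k u v : pure (k *: u) v = k *: pure u v.
Proof. by rewrite [RHS]tscale_pi. Qed.
Lemma pureZ k u v : pure (k *: u) v = pure u (k *: v).
Proof. by apply/tensor_pi; exact: teq_scale. Qed.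

Lemma tensor_sum (x : tensor) : x = \sum_(p <- repr x) pure p.1 p.2.
Proof. by rewrite -pi_sum reprK. Qed.

Lemma tensor_ind (P : tensor -> Prop) : P 0 ->
    (forall u v x, P x -> P (pure u v + x)) -> forall x, P x.
Proof.
move=> P0 PD x; rewrite (tensor_sum x).
by elim: (repr x) => [|p s IH]; rewrite ?big_nil ?big_cons //; exact: PD.
Qed.

End Tensor.

Notation "U ⊗ V" := (tensor U V) (at level 40, left associativity) : type_scope.
Notation "u ⊗ v" := (pure u v) (at level 40, left associativity) : ring_scope.

(* Used for 1 ⊗ 1 <> 0 in a tensor product of algebras. *)
Lemma separating_functional (K : fieldType) (V : lmodType K) (v : V) :
  v != 0 -> exists f : V -> K, f v = 1 /\
    forall k x y, f (k *: x + y) = k * f x + f y.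
Proof.
move=> v0.
pose P (W : set V) := ~ W v /\ forall k x y, W x -> W y -> W (k *: x + y).
have [F PF Ftot|W [[Wv Wl] Wmax]] := @Zorn_bigcup V P.
  split=> [[X FX Xv]|k x y [X FX Xx] [Y FY Yy]]; first by case: (PF _ FX).
  have [XY|YX] := Ftot _ _ FX FY.
    by exists Y => //; apply: (PF _ FY).2 => //; exact: XY.
  by exists X => //; apply: (PF _ FX).2 => //; exact: YX.
have W0 : W 0.
  have [[x Wx]|/forallNP W_] := pselect (exists x, W x).
    by rewrite -(subrr x) addrC -scaleN1r; exact: Wl.
  have P0 : P [set 0].
    split=> [/= v0'|k x y /= -> ->]; first by rewrite v0' eqxx in v0.
    by rewrite scaler0 addr0.
  have W0' : W `<` [set 0].
    by split=> [x /W_//|/(_ 0 erefl) /W_].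
  by have := Wmax _ W0' P0.
have Wz k x : W x -> W (k *: x) by move=> Wx; rewrite -[_ *: _]addr0; exact: Wl.
have Wd x y : W x -> W y -> W (x + y).
  by move=> Wx Wy; rewrite -[x]scale1r; exact: Wl.
have Wb x y : W x -> W y -> W (x - y).
  by move=> Wx Wy; rewrite addrC -scaleN1r; exact: Wl.
have ex x : exists k, W (x - k *: v).
  have [Wx|Wx] := pselect (W x); first by exists 0; rewrite scale0r subr0.
  pose W' := [set y | exists k w, W w /\ y = k *: x + w].
  have WW' : W `<` W'.
    split=> [w Ww|W'W]; first by exists 0, w; rewrite scale0r add0r.
    by apply/Wx/W'W; exists 1, 0; rewrite scale1r addr0.
  have W'l k y z : W' y -> W' z -> W' (k *: y + z).
    move=> [a [w [Ww ->]]] [b [w' [Ww' ->]]].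
    exists (k * a + b), (k *: w + w'); split; first exact: Wl.
    by rewrite scalerDr scalerA scalerDl addrACA.
  have [[k [w [Ww vE]]]|W'v] := pselect (W' v); last first.
    by have := Wmax _ WW' (conj W'v W'l).
  have k0 : k != 0.
    by apply/negP => /eqP k0; apply: Wv; rewrite vE k0 scale0r add0r.
  exists k^-1; rewrite vE scalerDr scalerA mulVf// scale1r opprD addrA subrr.
  by rewrite add0r -scaleNr; exact: Wz.
have un x a b : W (x - a *: v) -> W (x - b *: v) -> a = b.
  move=> Wa Wb'; apply/eqP/negPn/negP => ab; apply: Wv.
  have : W ((x - a *: v) - (x - b *: v)) by exact: Wb.
  rewrite opprB addrC addrA subrK addrC -scaleNr -scalerDl => /(Wz (- a + b)^-1).
  by rewrite scalerA mulVf ?scale1r// addrC subr_eq0 eq_sym.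
exists (fun x => projT1 (cid (ex x))); split.
  by case: cid => /= k Wk; apply: un Wk _; rewrite scale1r subrr.
move=> k x y; case: cid => a /=; case: cid => b /= Wb'; case: cid => c /= Wc Wa.
apply: un Wa _; rewrite scalerDl -scalerA opprD addrACA -scalerBr.
exact: Wl.
Qed.

Section TensorAlgebra.
Variables (K : fieldType) (A B : algType K).
Implicit Types x y z : A ⊗ B.

Definition tmul x y : A ⊗ B :=
  tlift (fun a b => tlift (fun a' b' => (a * a') ⊗ (b * b')) y) x.

Lemma tmul_balanced a b :
  balanced (fun (a' : A) (b' : B) => (a * a') ⊗ (b * b')).
Proof.
split=> *; rewrite ?mulrDr ?pureDl ?pureDr//.
by rewrite -!scalerAr pureZ.
Qed.

Lemma tmul_balanced2 y : balanced
  (fun a b => tlift (fun a' b' => (a * a') ⊗ (b * b')) y).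
Proof.
split=> *; rewrite -?big_split; apply: eq_bigr => p _.
- by rewrite mulrDl pureDl.
- by rewrite mulrDl pureDr.
- by rewrite -!scalerAl pureZ.
Qed.

Lemma tmul_pure a b a' b' : tmul (a ⊗ b) (a' ⊗ b') = (a * a') ⊗ (b * b').
Proof.
by rewrite /tmul tlift_pure ?tlift_pure//;
  [exact: tmul_balanced|exact: tmul_balanced2].
Qed.

Fact tmulDl : left_distributive tmul +%R.
Proof. by move=> x y z; rewrite /tmul tliftD//; exact: tmul_balanced2. Qed.

Fact tmulDr : right_distributive tmul +%R.
Proof.
move=> x y z; rewrite /tmul /tlift -big_split; apply: eq_bigr => p _.
exact: (tliftD (tmul_balanced _ _)).
Qed.

Lemma tmul0 x : tmul x 0 = 0.
Proof. by apply: (addrI (tmul x 0)); rewrite -tmulDr !addr0. Qed.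
Lemma t0mul x : tmul 0 x = 0.
Proof. by apply: (addrI (tmul 0 x)); rewrite -tmulDl !addr0. Qed.

Fact tmulA : associative tmul.
Proof.
move=> x y z; elim/tensor_ind: x => [|a b x IH]; first by rewrite !t0mul.
rewrite !tmulDl -{}IH; congr (_ + _).
elim/tensor_ind: y => [|a' b' y IH]; first by rewrite !(t0mul, tmul0).
rewrite !(tmulDl, tmulDr) -{}IH; congr (_ + _).
elim/tensor_ind: z => [|a'' b'' z IH]; first by rewrite !tmul0.
by rewrite !tmulDr -{}IH !tmul_pure !mulrA.
Qed.

Fact tmul1l : left_id (1 ⊗ 1) tmul.
Proof.
elim/tensor_ind => [|a b x IH]; first by rewrite tmul0.
by rewrite tmulDr tmul_pure IH !mul1r.
Qed.
Fact tmul1r : right_id (1 ⊗ 1) tmul.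
Proof.
elim/tensor_ind => [|a b x IH]; first by rewrite t0mul.
by rewrite tmulDl tmul_pure IH !mulr1.
Qed.

Fact tensor_nontriv : (1 ⊗ 1 : A ⊗ B) != 0.
Proof.
have [f [f1 fl]] := separating_functional (oner_neq0 A).
have [g [g1 gl]] := separating_functional (oner_neq0 B).
have fD (x y : A) : f (x + y) = f x + f y by rewrite -[x]scale1r fl mul1r scale1r.
have gD (x y : B) : g (x + y) = g x + g y by rewrite -[x]scale1r gl mul1r scale1r.
have f0 : f 0 = 0 by apply: (addrI (f 0)); rewrite -fD !addr0.
have g0 : g 0 = 0 by apply: (addrI (g 0)); rewrite -gD !addr0.
have bfg : balanced (fun (a : A) (b : B) => f a * g b).
  split=> [u u' v|u v v'|k u v]; first by rewrite fD mulrDl.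
    by rewrite gD mulrDr.
  by rewrite -[_ *: u]addr0 -[_ *: v]addr0 fl gl f0 g0 !addr0 mulrCA mulrA.
apply/eqP => /(congr1 (tlift (fun a b => f a * g b))).
by rewrite tlift_pure// tlift0// f1 g1 mulr1 => /eqP; rewrite oner_eq0.
Qed.

HB.instance Definition _ := GRing.Zmodule_isNzRing.Build (tensor A B)
  tmulA tmul1l tmul1r tmulDl tmulDr tensor_nontriv.

Lemma pureM (a a' : A) (b b' : B) : a ⊗ b * (a' ⊗ b') = (a * a') ⊗ (b * b').
Proof. exact: tmul_pure. Qed.

Fact t_scalerAl (k : K) x y : k *: (x * y) = (k *: x) * y.
Proof.
elim/tensor_ind: x => [|a b x IH]; first by rewrite mul0r !scaler0 mul0r.
rewrite mulrDl !scalerDr mulrDl -{}IH; congr (_ + _).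
elim/tensor_ind: y => [|a' b' y IH]; first by rewrite !mulr0 scaler0.
rewrite !mulrDr scalerDr {}IH; congr (_ + _).
by rewrite -pureZl !pureM -pureZl scalerAl.
Qed.
HB.instance Definition _ :=
  GRing.Lmodule_isLalgebra.Build K (tensor A B) t_scalerAl.
Fact t_scalerAr (k : K) x y : k *: (x * y) = x * (k *: y).
Proof.
elim/tensor_ind: x => [|a b x IH]; first by rewrite !mul0r scaler0.
rewrite !mulrDl scalerDr {}IH; congr (_ + _).
elim/tensor_ind: y => [|a' b' y IH]; first by rewrite !(scaler0, mulr0).
rewrite scalerDr !mulrDr scalerDr {}IH; congr (_ + _).
by rewrite -pureZl !pureM -pureZl scalerAr.
Qed.
HB.instance Definition _ :=
  GRing.Lalgebra_isAlgebra.Build K (tensor A B) t_scalerAr.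

End TensorAlgebra.

Section Opposite_product.
Variables (K : fieldType) (A : algType K).

(* \sum_j a_j ⊗ b_j^op |-> \sum_j a_j b_j *)
Definition op_mult (X : A ⊗ A^c) : A := tlift (fun a (b : A^c) => a * (b : A)) X.

Definition normalized (X : A ⊗ A^c) : Prop := op_mult X = 1.

Lemma op_multE n (a b : 'I_n -> A) :
  op_mult (\sum_j a j ⊗ toop (b j)) = \sum_j a j * b j.
Proof.
have bm : balanced (fun (a : A) (b : A^c) => a * (b : A)).
  by split=> *; [exact: mulrDl|exact: mulrDr|rewrite -scalerAl -scalerAr].
by rewrite /op_mult tlift_sum//; apply: eq_bigr => j _; rewrite tlift_pure.
Qed.
End Opposite_product.

(** * Universal one-forms *)

(* Omega^1(B) is realized as the kernel of the multiplication B ⊗ B -> B,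
   with outer bimodule structure and delta b = 1 ⊗ b - b ⊗ 1. *)
Section OneForms.
Variables (K : fieldType) (B : algType K).
Implicit Types (a b : B) (w : B ⊗ B).

Definition mult_map w : B := tlift *%R w.

Lemma mult_balanced : balanced ( *%R : B -> B -> B).
Proof.
split=> *; [exact: mulrDl|exact: mulrDr|by rewrite -scalerAl -scalerAr].
Qed.

Definition one_form : {pred B ⊗ B} := fun w => mult_map w == 0.

Lemma one_formE w : (w \in one_form) = (mult_map w == 0).
Proof. by []. Qed.

Fact one_form_zmod : zmod_closed one_form.
Proof.
split; first by rewrite one_formE /mult_map tlift0//; exact: mult_balanced.
move=> x y; rewrite !one_formE /mult_map tliftB ?subr_eq0//; last exact: mult_balanced.
by move=> /eqP-> /eqP->.
Qed.
HB.instance Definition _ := GRing.isZmodClosed.Build (tensor B B) one_form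
  one_form_zmod.

Record Omega1 : Type := MkOmega1 {
  Omega1_val :> tensor B B;
  Omega1_valP : Omega1_val \in one_form
}.
HB.instance Definition _ := [isSub for Omega1_val].
HB.instance Definition _ := [Choice of Omega1 by <:].
HB.instance Definition _ := [SubChoice_isSubZmodule of Omega1 by <:].

Lemma mult_mapM a b w : mult_map (a ⊗ 1 * w * (1 ⊗ b)) = a * mult_map w * b.
Proof.
have bm := mult_balanced; rewrite /mult_map.
elim/tensor_ind: w => [|x y w IH].
  by rewrite mulr0 mul0r tlift0// mulr0 mul0r.
rewrite !(mulrDr, mulrDl) !tliftD// {}IH !mulrDr !mulrDl; congr (_ + _).
by rewrite !pureM !tlift_pure// mulr1 mul1r !mulrA.
Qed.

Fact one_formM a b w : w \in one_form -> a ⊗ 1 * w * (1 ⊗ b) \in one_form.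
Proof. by rewrite !one_formE mult_mapM => /eqP->; rewrite mulr0 mul0r. Qed.

(* The bimodule action a w b. *)
Definition bimod a (w : Omega1) b : Omega1 :=
  MkOmega1 (one_formM a b (Omega1_valP w)).

Fact delta_subproof b : 1 ⊗ b - b ⊗ 1 \in one_form.
Proof.
have bm := mult_balanced.
by rewrite one_formE /mult_map tliftB// !tlift_pure// mulr1 mul1r subrr.
Qed.
Definition delta b : Omega1 := MkOmega1 (delta_subproof b).

Lemma deltaM a b : delta (a * b) = bimod a (delta b) 1 + bimod 1 (delta a) b.
Proof.
apply: val_inj; rewrite /= !(mulrBr, mulrBl) !pureM !(mulr1, mul1r).
by rewrite [RHS]addrC addrA subrK.
Qed.

(* Any tensor presentation of a one-form presents it as \sum_j a_j delta(b_j). *)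
Lemma Omega1_span (w : Omega1) (s : seq (B * B)) :
  Omega1_val w = \sum_(p <- s) p.1 ⊗ p.2 ->
  w = \sum_(p <- s) bimod p.1 (delta p.2) 1.
Proof.
move=> ws; apply: val_inj; have bm := mult_balanced.
rewrite [RHS](raddf_sum \val) /= ws.
under [RHS]eq_bigr do rewrite mulr1 mulrBr !pureM !(mulr1, mul1r).
rewrite big_split /= sumrN.
have /eqP : mult_map w == 0 := Omega1_valP w.
rewrite /mult_map ws tlift_sum// => ms.
rewrite [X in _ - X](_ : _ = (\sum_(p <- s) p.1 * p.2) ⊗ 1); last first.
  elim: s {ws ms} => [|p s IH]; last by rewrite !big_cons pureDl IH.
  rewrite !big_nil; apply: (addrI (0 ⊗ 1)).
  by rewrite -pureDl !addr0.
rewrite (eq_bigr (fun p => tlift *%R (p.1 ⊗ p.2))); last first.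
  by move=> p _; rewrite tlift_pure.
rewrite ms; apply/eqP; rewrite eq_sym subr_eq -subr_eq0 opprD addrA subrr.
rewrite sub0r oppr_eq0; apply/eqP; apply: (addrI (0 ⊗ 1)).
by rewrite -pureDl !addr0.
Qed.

(* eta_form (\sum_j a_j ⊗ b_j^op) = \sum_j a_j delta(b_j) *)
Definition eta_form (X : B ⊗ B^c) : Omega1 :=
  tlift (fun a (b : B^c) => bimod a (delta b) 1) X.

Lemma eta_form_balanced :
  balanced (fun (a : B) (b : B^c) => bimod a (delta b) 1 : Omega1).
Proof.
split=> [u u' v|u v v'|k u v]; apply: val_inj; rewrite /= !mulr1.
- by rewrite pureDl mulrDl.
- by rewrite pureDr pureDl opprD addrACA mulrDr.
- rewrite !mulrBr !pureM !(mulr1, mul1r) pureZ; congr (_ - _).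
  by rewrite -scalerAl -scalerAr.
Qed.

Lemma eta_formE n (a b : 'I_n -> B) :
  eta_form (\sum_j a j ⊗ toop (b j)) = \sum_j bimod (a j) (delta (b j)) 1.
Proof.
rewrite /eta_form tlift_sum; last exact: eta_form_balanced.
by apply: eq_bigr => j _; rewrite tlift_pure//; exact: eta_form_balanced.
Qed.

End OneForms.

(** * Unbounded operators *)

(* A partially defined operator: T x = Some y iff x is in the domain of T and
   y is its image.  Sums, products and commutators carry their natural domains,
   and equality of operators includes equality of domains. *)
Definition uop (H : Type) : Type := H -> option H.

HB.instance Definition _ (H : Type) := gen_eqMixin (uop H).
HB.instance Definition _ (H : Type) := gen_choiceMixin (uop H).

Section UnboundedOperators.
Variable H : zmodType.
Implicit Types (S T : uop H) (f : H -> H).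

Definition uop_dom T : set H := [set x | T x].

Definition uop_add S T : uop H := fun x =>
  if S x is Some u then if T x is Some v then Some (u + v) else None else None.
Definition uop_opp T : uop H := fun x => omap -%R (T x).
Definition uop_comp S T : uop H := fun x => obind S (T x).

(* An everywhere defined operator. *)
Definition total_op f : uop H := fun x => Some (f x).

Definition uop_comm S T : uop H :=
  uop_add (uop_comp S T) (uop_opp (uop_comp T S)).

Fact uop_addA : associative uop_add.
Proof.
move=> S T U; apply: funext => x; rewrite /uop_add.
by case: (S x) (T x) (U x) => [?|] [?|] [?|] //; rewrite addrA.
Qed.
Fact uop_addC : commutative uop_add.
Proof.
move=> S T; apply: funext => x; rewrite /uop_add.
by case: (S x) (T x) => [?|] [?|] //; rewrite addrC.
Qed.
Fact uop_add0 : left_id (total_op (fun=> 0)) uop_add.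
Proof.
move=> T; apply: funext => x; rewrite /uop_add /=.
by case: (T x) => [?|] //; rewrite add0r.
Qed.
HB.instance Definition _ :=
  GRing.isNmodule.Build (uop H) uop_addA uop_addC uop_add0.

End UnboundedOperators.

Notation "S ** T" := (uop_comp S T) (at level 40, left associativity) : ring_scope.
Notation "[[ S , T ]]" := (uop_comm S T) (at level 0, format "[[ S ,  T ]]") :
  ring_scope.

Section HilbertOperators.
Variables (K : numClosedFieldType) (H : normedModType K).
Variable inner : {dot H for @Num.conj K}.
Implicit Types (T : uop H) (f : H -> H).

Definition bounded_map f : Prop := exists M : K, forall x, `|f x| <= M * `|x|.

Definition bounded_linear f : Prop := linear f /\ bounded_map f.

(* Linearity, including that the domain is a linear subspace. *)
Definition uop_linear T : Prop :=
  T 0 = Some 0 /\ forall k x y u v,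
    T x = Some u -> T y = Some v -> T (k *: x + y) = Some (k *: u + v).

(* T is bounded on its domain, i.e. extends to a bounded operator if that
   domain is dense. *)
Definition uop_bounded T : Prop :=
  exists M : K, forall x y, T x = Some y -> `|y| <= M * `|x|.

(* The graph of T is the graph of its adjoint: y is in the domain of T^* with
   T^* y = z iff <T x, y> = <x, z> for all x in the domain of T. *)
Definition self_adjoint T : Prop :=
  [/\ uop_linear T, dense (uop_dom T) &
      forall y z, T y = Some z <->
        (forall x u, T x = Some u -> inner u y = inner x z)].

Definition compact_operator f : Prop :=
  bounded_linear f /\ compact (closure (f @` [set x | `|x| <= 1])).

Definition is_resolvent T (lam : K) (S : H -> H) : Prop :=
  let Tlam := T + total_op (fun x => - (lam *: x)) in
  [/\ bounded_linear S,
      Tlam ** total_op S = total_op id &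
      forall x y, Tlam x = Some y -> S y = x].

Definition compact_resolvent T : Prop :=
  exists lam S, is_resolvent T lam S /\ compact_operator S.

Definition star_representation (A : starAlgType K) (pi : A -> H -> H) : Prop :=
  [/\ forall a, bounded_linear (pi a),
      forall k a b x, pi (k *: a + b) x = k *: pi a x + pi b x,
      forall a b x, pi (a * b) x = pi a (pi b x),
      forall x, pi 1 x = x &
      forall a x y, inner (pi a x) y = inner x (pi (star a) y)].

Definition antilinear_isometry (J : H -> H) : Prop :=
  (forall k x y, J (k *: x + y) = k^* *: J x + J y) /\
  forall x, `|J x| = `|x|.

End HilbertOperators.

(** * Real spectral triples *)

(* [conj_op J Jinv T] is J T J^-1. *)
Definition conj_op (H : zmodType) (J Jinv : H -> H) (T : uop H) : uop H :=
  total_op J ** T ** total_op Jinv.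

(* Here [Jinv] is the inverse of [J]; the first-order condition is not
   required. *)
Record real_spectral_triple (R : realType) (A : starAlgType R[i])
    (H : completeNormedModType R[i]) (inner : {dot H for @Num.conj R[i]})
    (pi : A -> H -> H) (D : uop H) (J Jinv : H -> H) : Prop := {
  rst_norm : forall x, `|x| ^+ 2 = inner x x;
  rst_rep : star_representation inner pi;
  rst_selfadj : self_adjoint inner D;
  rst_resolvent : compact_resolvent D;
  rst_dom : forall a x, uop_dom D x -> uop_dom D (pi a x);
  rst_comm : forall a, uop_bounded [[D, total_op (pi a)]];
  rst_J : antilinear_isometry J;
  rst_JK : cancel J Jinv;
  rst_JinvK : cancel Jinv J;
  rst_J2 : (forall x, J (J x) = x) \/ (forall x, J (J x) = - x);
  rst_JD : conj_op J Jinv D = D \/ conj_op J Jinv D = uop_opp D;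
  rst_order0 : forall a b,
    total_op (pi a) ** conj_op J Jinv (total_op (pi b)) =
    conj_op J Jinv (total_op (pi b)) ** total_op (pi a)
}.

(** * Inner fluctuations *)

Section Fluctuations.
Variables (K : numClosedFieldType) (H : lmodType K).
Implicit Type T : uop H.

(* T + \sum_k x_k [T, y_k] for the one-form \sum_k x_k delta(y_k) of an algebra
   B acting through [rho]; by [Omega1_span], the representative of a one-form
   as a tensor is such a presentation. *)
Definition inner_fluctuation (B : algType K) (rho : B -> H -> H) T
    (w : Omega1 B) : uop H :=
  T + \sum_(p <- repr (Omega1_val w))
        total_op (rho p.1) ** [[T, total_op (rho p.2)]].

Variables (A : algType K) (pi : A -> H -> H) (J Jinv : H -> H).

Let op a : uop H := total_op (pi a).
Let hat a : uop H := conj_op J Jinv (op a).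

(* T(w) computed on the presentation w = \sum_j a_j delta(b_j); for a linear T
   with domain Dom(D) the value does not depend on the presentation. *)
Definition fluct_pres T (s : seq (A * A)) : uop H :=
  T + \sum_(p <- s) op p.1 ** [[T, op p.2]]
    + \sum_(p <- s) hat p.1 ** [[T, hat p.2]]
    + \sum_(p <- s) \sum_(q <- s)
        hat p.1 ** [[op q.1 ** [[T, op q.2]], hat p.2]].

Definition fluct T (w : Omega1 A) : uop H := fluct_pres T (repr (Omega1_val w)).

(* The action a ⊗ hat b |-> a J b J^-1. *)
Definition tensor_rep (X : A ⊗ conj_alg A) : H -> H := fun x =>
  tlift (fun a (b : conj_alg A) => pi a (J (pi (b : A) (Jinv x)))) X.

End Fluctuations.

(* Main.v *)
(* Let V be the domain of D.  If a representation L of an algebra stabilizes V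
   and \sum_j a_j b_j = 1, then the terms \sum_j L(a_j) L(b_j) d x of the
   commutators cancel and d + \sum_j L(a_j) [d, L(b_j)] becomes the sandwich
   \sum_j L(a_j) d L(b_j).  Applying this to the action of A and then to that of
   J A J^-1 gives
     T(eta(A)) = \sum_(i, j) hat a_i a_j T b_j hat b_i,
   while applying it to A ⊗ hat A gives
     \sum_(i, j) a_i hat a_j D b_i hat b_j.
   Since A and J A J^-1 commute, the two agree for T = D, and iterating the first
   formula multiplies the tensors. *)
Require Import Defs.
From HB Require Import structures.
From mathcomp Require Import all_boot all_order all_algebra sesquilinear.
From mathcomp Require Import complex.
From mathcomp Require Import all_classical all_reals all_analysis.

Set Implicit Arguments.
Unset Strict Implicit.
Unset Printing Implicit Defensive.

Import Order.TTheory GRing.Theory Num.Theory.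
Import numFieldNormedType.Exports.
Local Open Scope ring_scope.
Local Open Scope quotient_scope.

(** * Normalized tensors and one-forms computed on lists of pairs *)

Section TensorPresentations.
Variables (K : fieldType) (B : algType K).
Implicit Types (s t : seq (B * B^c)).

Lemma tensor_mul_pi (B1 B2 : algType K) (s t : seq (B1 * B2)) :
  \pi_(tensor B1 B2) s * \pi_(tensor B1 B2) t =
  \pi_(tensor B1 B2) [seq (p.1 * q.1, p.2 * q.2) | p <- s, q <- t].
Proof.
rewrite !pi_sum big_allpairs_dep mulr_suml; apply: eq_bigr => p _.
by rewrite mulr_sumr; apply: eq_bigr => q _; rewrite pureM.
Qed.

Lemma op_mult_pi t :
  op_mult (\pi_(tensor B B^c) t) = \sum_(p <- t) p.1 * (p.2 : B).
Proof.
rewrite /op_mult tlift_pi//.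
by split=> *; [exact: mulrDl|exact: mulrDr|rewrite -scalerAl -scalerAr].
Qed.

(** The opposite factor multiplies in reverse order, so the inner sum collapses: a_i (sum_j a'_j
    b'_j) b_i = a_i b_i. *)
Lemma normalizedM (X Y : B ⊗ B^c) :
  normalized X -> normalized Y -> normalized (X * Y).
Proof.
elim/tensorW: X => s; elim/tensorW: Y => t.
rewrite /normalized tensor_mul_pi !op_mult_pi big_allpairs_dep /= => s1 t1.
rewrite -[RHS]s1; apply: eq_bigr => p _.
have -> : p.1 * (p.2 : B) = p.1 * (\sum_(q <- t) q.1 * (q.2 : B)) * (p.2 : B).
  by rewrite t1 mulr1.
rewrite mulr_sumr mulr_suml; apply: eq_bigr => q _.
by rewrite -[(p.2 * q.2 : B^c)]/((q.2 : B) * (p.2 : B)) !mulrA.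
Qed.

(** As a tensor, a delta(b) is a ⊗ b - ab ⊗ 1. This evaluates sums over the arbitrary representative
    of a one-form. *)
Lemma eta_form_lift (W : zmodType) (f : B -> B -> W) t : balanced f ->
  tlift f (Omega1_val (eta_form (\pi_(tensor B B^c) t))) =
  \sum_(p <- t) f p.1 (p.2 : B) - f (op_mult (\pi_(tensor B B^c) t)) 1.
Proof.
move=> bf; rewrite /eta_form tlift_pi; last exact: eta_form_balanced.
rewrite op_mult_pi [X in tlift _ X](raddf_sum val) /= tlift_sum//.
have f0 : f 0 1 = 0 by apply: (addrI (f 0 1)); case: bf => <- *; rewrite !addr0.
have fD : {morph f^~ 1 : x y / x + y} by move=> x y; case: bf.
rewrite (big_morph (f^~ 1) fD f0) -sumrB; apply: eq_bigr => p _.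
by rewrite mulr1 mulrBr !pureM !(mulr1, mul1r) tliftB// !tlift_pure.
Qed.

End TensorPresentations.

(** * Sandwich operators for one representation *)

Section Representations.
Variables (K : numClosedFieldType) (H : lmodType K).
Implicit Types (V : {pred H}) (d : H -> H).

(** An operator with domain [V] is coded by a total map with arbitrary values off [V], so linearity
    is asked on [V] only. *)
Definition linear_on V d : Prop :=
  forall k, {in V &, forall x y, d (k *: x + y) = k *: d x + d y}.

(* [c] is the identity for the action of the algebra and of its tensor square,
   and the conjugation for [a |-> J a J^-1]. *)
Record repr_on V (c : K -> K) (B : algType K) (L : B -> H -> H) : Prop := {
  repr_linear : forall a, linear (L a);
  reprDl : forall a b x, L (a + b) x = L a x + L b x;
  reprZl : forall k a x, L (k *: a) x = c k *: L a x;
  reprM : forall a b x, L (a * b) x = L a (L b x);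
  repr1 : forall x, L 1 x = x;
  repr_stable : forall a x, x \in V -> L a x \in V
}.

Section OneRepresentation.
Variables (V : {pred H}) (c : K -> K) (B : algType K) (L : B -> H -> H).
Hypotheses (Vsub : submod_closed V) (HL : repr_on V c L).

Lemma reprD a x y : L a (x + y) = L a x + L a y.
Proof. by rewrite -[x]scale1r (repr_linear HL) !scale1r. Qed.

Lemma repr0 a : L a 0 = 0.
Proof. by apply: (addrI (L a 0)); rewrite -reprD !addr0. Qed.

Lemma reprZ a k x : L a (k *: x) = k *: L a x.
Proof. by rewrite -[_ *: x]addr0 (repr_linear HL) repr0 addr0. Qed.

Lemma reprB a x y : L a (x - y) = L a x - L a y.
Proof. by rewrite reprD -scaleN1r reprZ scaleN1r. Qed.

Lemma repr_sum a I (r : seq I) (F : I -> H) :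
  L a (\sum_(i <- r) F i) = \sum_(i <- r) L a (F i).
Proof. exact: (big_morph _ (reprD a) (repr0 a)). Qed.

Lemma repr0l x : L 0 x = 0.
Proof. by apply: (addrI (L 0 x)); rewrite -(reprDl HL) !addr0. Qed.

Lemma repr_suml x I (r : seq I) (F : I -> B) :
  L (\sum_(i <- r) F i) x = \sum_(i <- r) L (F i) x.
Proof. exact: (big_morph (L^~ x) (fun a b => reprDl HL a b x) (repr0l x)). Qed.

Section Sandwich.
Variable d : H -> H.
Hypothesis dlin : linear_on V d.

Lemma linear_onD : {in V &, {morph d : x y / x + y}}.
Proof. by move=> x y Vx Vy; rewrite -[x]scale1r dlin// !scale1r. Qed.

Lemma linear_on0 : d 0 = 0.
Proof.
by case: Vsub => V0 _; apply: (addrI (d 0)); rewrite -linear_onD// !addr0.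
Qed.

Lemma linear_onZ k : {in V, forall x, d (k *: x) = k *: d x}.
Proof.
case: Vsub => V0 _ x Vx.
by rewrite -[k *: x]addr0 dlin// linear_on0 addr0.
Qed.

Definition sandwich (t : seq (B * B^c)) (x : H) : H :=
  \sum_(p <- t) L p.1 (d (L p.2 x)).

Lemma sandwich_linear_on t : linear_on V (sandwich t).
Proof.
move=> k x y Vx Vy; rewrite /sandwich scaler_sumr -big_split /=.
apply: eq_bigr => p _.
by rewrite (repr_linear HL) dlin ?(repr_stable HL)// (repr_linear HL).
Qed.

(** The scalar [c k] passes through [d] and the linear map [L a], so k moves between the factors for
    conjugation as well as for the identity. *)
Lemma commutator_balanced x : x \in V ->
  balanced (fun a b => L a (d (L b x) - L b (d x))).
Proof.
move=> Vx; split=> [u u' v|u v v'|k u v]; first exact: (reprDl HL).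
- rewrite !(reprDl HL) linear_onD ?(repr_stable HL)//.
  by rewrite -(reprD u) opprD addrACA.
- rewrite !(reprZl HL) linear_onZ ?(repr_stable HL)//.
  by rewrite -scalerBr reprZ.
Qed.

Lemma sum_commutator t x : normalized (\pi_(tensor B B^c) t) ->
  d x + \sum_(p <- t) L p.1 (d (L p.2 x) - L p.2 (d x)) = sandwich t x.
Proof.
rewrite /normalized op_mult_pi => t1.
under eq_bigr do rewrite reprB -(reprM HL).
by rewrite sumrB -repr_suml t1 (repr1 HL) addrC subrK.
Qed.

(* As a tensor eta(X) is X - m ⊗ 1 with m = \sum_j a_j b_j, and the term m ⊗ 1
   contributes m [d, 1] = 0. *)
Lemma sum_eta_form_commutator t x : normalized (\pi_(tensor B B^c) t) ->
  x \in V ->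
  d x + \sum_(p <- repr (Omega1_val (eta_form (\pi_(tensor B B^c) t))))
    L p.1 (d (L p.2 x) - L p.2 (d x)) = sandwich t x.
Proof.
move=> t1 Vx; rewrite -(sum_commutator _ t1); congr (_ + _).
have /(eta_form_lift t) := commutator_balanced Vx.
by rewrite !(repr1 HL) subrr repr0 subr0.
Qed.

End Sandwich.
End OneRepresentation.

(** * Operators with domain [V] and their commutators *)

Definition restrict V d : uop H := fun x => if x \in V then Some (d x) else None.

Lemma eq_restrict V d e : {in V, d =1 e} -> restrict V d = restrict V e.
Proof.
by move=> de; apply: funext => x; rewrite /restrict; case: ifP => // /de ->.
Qed.

Lemma restrictD V d e : restrict V d + restrict V e = restrict V (d \+ e).
Proof.
by apply: funext => x; rewrite [LHS]/(uop_add _ _ x) /uop_add /restrict; case: ifP.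
Qed.

(** The leading term fixes the domain: an empty sum is the zero operator on all of [H]. *)
Lemma restrict_sum V d I (r : seq I) (e : I -> H -> H) :
  restrict V d + \sum_(i <- r) restrict V (e i) =
  restrict V (fun x => d x + \sum_(i <- r) e i x).
Proof.
elim: r d => [|i r IH] d.
  by rewrite big_nil addr0; apply: eq_restrict => x _; rewrite big_nil addr0.
rewrite big_cons addrA restrictD IH; apply: eq_restrict => x _.
by rewrite big_cons /= addrA.
Qed.

Lemma restrict_sum2 V d I J (r : seq I) (s : seq J) (e : I -> J -> H -> H) :
  restrict V d + \sum_(i <- r) \sum_(j <- s) restrict V (e i j) =
  restrict V (fun x => d x + \sum_(i <- r) \sum_(j <- s) e i j x).
Proof.
rewrite -(@big_allpairs _ _ _ _ _ r s (fun p => restrict V (e p.1 p.2))) restrict_sum.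
by apply: eq_restrict => x _; rewrite big_allpairs_dep.
Qed.

Lemma restrict_total V (f : H -> H) d :
  total_op f ** restrict V d = restrict V (f \o d).
Proof. by apply: funext => x; rewrite /uop_comp /restrict; case: ifP. Qed.

(** One product has domain [V], the other the preimage of [V] under [f], which contains [V] by
    stability. *)
Lemma restrict_comm V (f : H -> H) d : (forall x, x \in V -> f x \in V) ->
  [[restrict V d, total_op f]] = restrict V (fun x => d (f x) - f (d x)).
Proof.
move=> fV; apply: funext => x.
rewrite /uop_comm /uop_add /uop_opp /uop_comp /restrict /=.
have [Vx|_] := boolP (x \in V); first by rewrite fV.
by case: ifP.
Qed.

Lemma repr_restrict_comm V c (B : algType K) (L : B -> H -> H) d a b :
  repr_on V c L ->
  total_op (L a) ** [[restrict V d, total_op (L b)]] =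
  restrict V (fun x => L a (d (L b x) - L b (d x))).
Proof.
by move=> HL; rewrite restrict_comm ?restrict_total//; exact: (repr_stable HL).
Qed.

Lemma inner_fluctuation_eta V (B : algType K) (L : B -> H -> H) d t :
  submod_closed V -> repr_on V id L -> linear_on V d ->
  normalized (\pi_(tensor B B^c) t) ->
  inner_fluctuation L (restrict V d) (eta_form (\pi_(tensor B B^c) t)) =
  restrict V (sandwich L d t).
Proof.
move=> Vsub HL dlin t1; rewrite /inner_fluctuation.
under eq_bigr do rewrite (repr_restrict_comm _ _ _ HL).
rewrite restrict_sum; apply: eq_restrict => x Vx.
exact: (sum_eta_form_commutator Vsub HL).
Qed.

(** * Fluctuations as double sandwiches, and their composition *)

Section Fluct.
Variables (V : {pred H}) (c : K -> K) (A : algType K).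
Variables (pi : A -> H -> H) (J Jinv : H -> H).
Let hat a x := J (pi a (Jinv x)).
Hypotheses (Vsub : submod_closed V) (Hpi : repr_on V id pi).
Hypothesis Hhat : repr_on V c hat.

(** The [hat] terms regroup as hat a_j [T + sum_k a_k [T, b_k], hat b_j], so the sandwich formula
    applies to [pi] and [d], then to [hat] and the resulting sandwich. *)
Lemma fluct_eta d t : linear_on V d -> normalized (\pi_(tensor A A^c) t) ->
  fluct pi J Jinv (restrict V d) (eta_form (\pi_(tensor A A^c) t)) =
  restrict V (sandwich hat (sandwich pi d t) t).
Proof.
move=> dlin t1; rewrite /fluct /fluct_pres; set s := repr _.
under eq_bigr do rewrite (repr_restrict_comm _ _ _ Hpi).
rewrite restrict_sum.
under eq_bigr do rewrite (repr_restrict_comm _ _ _ Hhat).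
rewrite restrict_sum.
under eq_bigr do under eq_bigr do
  rewrite (repr_restrict_comm _ _ _ Hpi) (repr_restrict_comm _ _ _ Hhat).
rewrite restrict_sum2; apply: eq_restrict => x Vx.
have E y : y \in V ->
    d y + \sum_(p <- s) pi p.1 (d (pi p.2 y) - pi p.2 (d y)) = sandwich pi d t y.
  exact: (sum_eta_form_commutator Vsub Hpi).
rewrite -(sum_eta_form_commutator Vsub Hhat (sandwich_linear_on Hpi dlin t))//.
rewrite E// -addrA -big_split; congr (_ + _); apply: eq_bigr => p _ /=.
rewrite -(repr_sum Hhat) sumrB -(repr_sum Hhat) -(reprD Hhat) addrACA -opprD.
by rewrite -(reprD Hhat) !E ?(repr_stable Hhat).
Qed.

Hypothesis pi_hatC : forall a b x, pi a (hat b x) = hat b (pi a x).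

(** Commuting [pi] past [hat] joins the factors of [s] and [t] on each side of [d]; on the right
    they read b_t b_s, which is the product b_s b_t of [A^c]. *)
Lemma sandwich_comp d s t x :
  sandwich hat (sandwich pi (sandwich hat (sandwich pi d t) t) s) s x =
  sandwich hat (sandwich pi d [seq (p.1 * q.1, p.2 * q.2) | p <- s, q <- t])
    [seq (p.1 * q.1, p.2 * q.2) | p <- s, q <- t] x.
Proof.
rewrite /sandwich big_allpairs_dep; apply: eq_bigr => p _ /=.
rewrite (repr_sum Hhat).
under [LHS]eq_bigr do rewrite (repr_sum Hpi) (repr_sum Hhat).
(* The left side sums over s, s, t, t, the product lists over s, t, s, t. *)
rewrite exchange_big; apply: eq_bigr => q _ /=.
have hatMc b b' y : hat (b * b' : A^c) y = hat b' (hat b y) := reprM Hhat b' b y.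
have piMc b b' y : pi (b * b' : A^c) y = pi b' (pi b y) := reprM Hpi b' b y.
rewrite hatMc (reprM Hhat) big_allpairs_dep !(repr_sum Hhat).
apply: eq_bigr => r _.
rewrite pi_hatC (repr_sum Hpi) !(repr_sum Hhat); apply: eq_bigr => u _ /=.
by rewrite (reprM Hpi) piMc !pi_hatC.
Qed.

End Fluct.
End Representations.

(** * The action of A ⊗ hat A *)

Section TensorRepresentation.
Variables (K : numClosedFieldType) (H : lmodType K) (V : {pred H}).
Variables (A : algType K) (pi : A -> H -> H) (J Jinv : H -> H).
Let hat a x := J (pi a (Jinv x)).
Hypotheses (Hpi : repr_on V id pi) (Hhat : repr_on V Num.conj hat).
Hypothesis pi_hatC : forall a b x, pi a (hat b x) = hat b (pi a x).
Hypothesis Vsub : submod_closed V.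

(** A scalar k acts on [conj_alg A] as k^*, and [hat] conjugates it back to k. *)
Lemma tensor_rep_balanced x :
  balanced (fun a (b : conj_alg A) => pi a (J (pi (b : A) (Jinv x)))).
Proof.
split=> [u u' v|u v v'|k u v]; first exact: (reprDl Hpi).
  by rewrite -(reprD Hpi) -[in RHS](reprDl Hhat).
rewrite (reprZl Hpi) -[J (pi (_ *: _ : A) _)]/(hat (k^* *: (v : A)) x).
by rewrite (reprZl Hhat) conjCK (reprZ Hpi).
Qed.

Lemma tensor_rep_pure a (b : A) x :
  tensor_rep pi J Jinv (a ⊗ tohat b) x = pi a (hat b x).
Proof. exact: (tlift_pure (tensor_rep_balanced x)). Qed.

Lemma tensor_rep0 x : tensor_rep pi J Jinv 0 x = 0.
Proof. exact: (tlift0 (tensor_rep_balanced x)). Qed.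

Lemma tensor_repD X Y x :
  tensor_rep pi J Jinv (X + Y) x =
  tensor_rep pi J Jinv X x + tensor_rep pi J Jinv Y x.
Proof. exact: (tliftD (tensor_rep_balanced x)). Qed.

(** On pure tensors multiplicativity is the commutation a hat b a' hat b' = a a' hat b hat b';
    induction extends it to sums. *)
Lemma tensor_rep_repr : repr_on V id (tensor_rep pi J Jinv).
Proof.
have lin X : linear (tensor_rep pi J Jinv X).
  move=> k x y; elim/tensor_ind: X => [|a b X IH].
    by rewrite !tensor_rep0 scaler0 addr0.
  rewrite !tensor_repD {}IH !tensor_rep_pure scalerDr addrACA.
  by rewrite (repr_linear Hhat) (repr_linear Hpi).
split=> // [X Y x|k X x|X Y x|x|X x Vx].
- exact: tensor_repD.
- elim/tensor_ind: X => [|a b X IH]; first by rewrite scaler0 tensor_rep0 scaler0.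
  by rewrite scalerDr !tensor_repD IH -pureZl !tensor_rep_pure (reprZl Hpi) scalerDr.
- elim/tensor_ind: X => [|a b X IH]; first by rewrite mul0r !tensor_rep0.
  rewrite mulrDl !tensor_repD {}IH; congr (_ + _).
  elim/tensor_ind: Y => [|a' b' Y IH].
    by rewrite mulr0 !tensor_rep0 tensor_rep_pure (repr0 Hhat) (repr0 Hpi).
  rewrite mulrDr !tensor_repD {}IH pureM !tensor_rep_pure.
  rewrite (reprD Hhat) (reprD Hpi) (reprM Hpi); congr (pi _ _ + _).
  by rewrite -pi_hatC -(reprM Hhat).
- by rewrite tensor_rep_pure (repr1 Hhat) (repr1 Hpi).
- case: Vsub => V0 Vl.
  elim/tensor_ind: X => [|a b X IH]; first by rewrite tensor_rep0.
  rewrite tensor_repD tensor_rep_pure -[pi _ _]scale1r; apply: Vl => //.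
  by rewrite !(repr_stable Hpi) ?(repr_stable Hhat).
Qed.

End TensorRepresentation.

(** The sum factors as (sum_i a_i b_i) ⊗ (sum_j a'_j b'_j) = 1 ⊗ 1. With [B] the conjugate algebra
    it normalizes A ⊗ hat A. *)
Lemma normalized_tensor (K : fieldType) (A B : algType K)
    (s : seq (A * A^c)) (t : seq (B * B^c)) :
  normalized (\pi_(tensor A A^c) s) -> normalized (\pi_(tensor B B^c) t) ->
  normalized (\pi_(tensor (A ⊗ B)%type (A ⊗ B)^c%type)
    [seq (p.1 ⊗ q.1, (p.2 : A) ⊗ (q.2 : B)) | p <- s, q <- t]).
Proof.
rewrite /normalized !op_mult_pi big_allpairs_dep /= => s1 t1.
under eq_bigr do under eq_bigr do rewrite pureM.
have pure0 (b : B) : (0 : A) ⊗ b = 0.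
  by apply: (addrI (0 ⊗ b)); rewrite -pureDl !addr0.
have pure0r (a : A) : a ⊗ (0 : B) = 0.
  by apply: (addrI (a ⊗ 0)); rewrite -pureDr !addr0.
under eq_bigr do rewrite -(big_morph _ (pureDr _) (pure0r _)) t1.
by rewrite -(big_morph _ (fun x y => pureDl x y _) (pure0 _)) s1.
Qed.

(** * Domain and commuting representations of a real spectral triple *)

Section RealSpectralTriple.
Variables (R : realType) (A : starAlgType R[i]).
Variables (H : completeNormedModType R[i]) (inner : {dot H for @Num.conj R[i]}).
Variables (pi : A -> H -> H) (D : uop H) (J Jinv : H -> H).
Hypothesis HD : real_spectral_triple inner pi D J Jinv.
Let hat a x := J (pi a (Jinv x)).

Definition dom : {pred H} := [pred x | isSome (D x)].

(** The default value 0 occurs only off the domain, where [restrict] discards it. *)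
Lemma restrict_dom : D = restrict dom (fun x => odflt 0 (D x)).
Proof. by apply: funext => x; rewrite /restrict inE; case: (D x). Qed.

Lemma dom_submod : submod_closed dom.
Proof.
have [ [D0 Dlin] _ _] := rst_selfadj HD.
split=> [|k x y]; rewrite !inE ?D0//.
case Dx: (D x) => [u|]// _; case Dy: (D y) => [v|]// _.
by rewrite (Dlin _ _ _ _ _ Dx Dy).
Qed.

Lemma dom_linear : linear_on dom (fun x => odflt 0 (D x)).
Proof.
have [ [D0 Dlin] _ _] := rst_selfadj HD.
move=> k x y; rewrite !inE.
case Dx: (D x) => [u|]// _; case Dy: (D y) => [v|]// _.
by rewrite (Dlin _ _ _ _ _ Dx Dy).
Qed.

(** The equality J D J^-1 = ±D includes domains, and J D J^-1 is defined at [x] exactly when [D] is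
    at [Jinv x]. *)
Lemma dom_Jinv x : (Jinv x \in dom) = (x \in dom).
Proof.
have JD : isSome (conj_op J Jinv D x) = isSome (D x).
  by case: (rst_JD HD) => ->//; rewrite /uop_opp; case: (D x).
by rewrite !inE -JD /conj_op /uop_comp /=; case: (D (Jinv x)).
Qed.

Lemma dom_J x : (J x \in dom) = (x \in dom).
Proof. by rewrite -dom_Jinv (rst_JK HD). Qed.

Lemma Jinv_antilinear k x y : Jinv (k *: x + y) = k^* *: Jinv x + Jinv y.
Proof.
have [Jlin _] := rst_J HD.
by apply: (can_inj (rst_JK HD)); rewrite Jlin !(rst_JinvK HD) conjCK.
Qed.

Lemma pi_repr : repr_on dom id pi.
Proof.
have [pib pilin piM pi1 _] := rst_rep HD.
have piD a b x : pi (a + b) x = pi a x + pi b x.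
  by rewrite -[a]scale1r pilin !scale1r.
have pi0 x : pi 0 x = 0 by apply: (addrI (pi 0 x)); rewrite -piD !addr0.
split=> //; first by move=> a; case: (pib a).
  by move=> k a x; rewrite -[k *: a]addr0 pilin pi0 addr0.
exact: (rst_dom HD).
Qed.

(** Two antilinear maps around [pi a] make [hat a] linear, while scalars of the algebra meet only
    the outer [J]. *)
Lemma hat_repr : repr_on dom Num.conj hat.
Proof.
have [Jlin _] := rst_J HD; have Hpi := pi_repr.
have JD x y : J (x + y) = J x + J y by rewrite -[x]scale1r Jlin conjC1 !scale1r.
have J0 : J 0 = 0 by apply: (addrI (J 0)); rewrite -JD !addr0.
rewrite /hat; split=> [a k x y|a b x|k a x|a b x|x|a x Vx].
- by rewrite Jinv_antilinear (repr_linear Hpi) Jlin conjCK.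
- by rewrite (reprDl Hpi) JD.
- by rewrite (reprZl Hpi) -[k *: _]addr0 Jlin J0 addr0.
- by rewrite (reprM Hpi) (rst_JK HD).
- by rewrite (repr1 Hpi) (rst_JinvK HD).
- by rewrite dom_J (repr_stable Hpi) ?dom_Jinv.
Qed.

Lemma pi_hatC a b x : pi a (hat b x) = hat b (pi a x).
Proof. by have /(congr1 (@^~ x))[] := rst_order0 HD a b. Qed.

End RealSpectralTriple.

Theorem proposition5 (R : realType) (A : starAlgType R[i])
    (H : completeNormedModType R[i]) (inner : {dot H for @Num.conj R[i]})
    (pi : A -> H -> H) (D : uop H) (J Jinv : H -> H)
    (HD : real_spectral_triple inner pi D J Jinv) :
  let op a : uop H := total_op (pi a) in
  let hat a : uop H := conj_op J Jinv (op a) in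
  let fl := fluct pi J Jinv in
  (forall (n : nat) (a b : 'I_n -> A),
    \sum_j a j * b j = 1 ->
    let X : A ⊗ A^c := \sum_j a j ⊗ toop (b j) in
    let XX : ((A ⊗ conj_alg A) ⊗ (A ⊗ conj_alg A)^c)%type :=
      \sum_i \sum_j (a i ⊗ tohat (a j)) ⊗ toop (b i ⊗ tohat (b j)) in
    fl D (eta_form X) = inner_fluctuation (tensor_rep pi J Jinv) D (eta_form XX) /\
    fl D (eta_form X) =
      D + \sum_i \sum_j op (a i) ** hat (a j) ** [[D, op (b i) ** hat (b j)]]) /\
  (forall X X' : A ⊗ A^c, normalized X -> normalized X' ->
    fl (fl D (eta_form X)) (eta_form X') = fl D (eta_form (X' * X))).
Proof.
move=> op hat fl.
have [Vsub dlin] := (dom_submod HD, dom_linear HD).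
have [Hpi Hhat] := (pi_repr HD, hat_repr HD).
have Hrho := tensor_rep_repr Hpi Hhat (pi_hatC HD) Vsub.
set V := dom D in Vsub dlin Hpi Hhat Hrho.
set d := fun x => odflt 0 (D x) in dlin.
have DE : D = restrict V d by exact: restrict_dom.
split=> [n a b ab1 X XX|X X'].
  pose t : seq (A * A^c) := [seq (a j, toop (b j)) | j <- index_enum 'I_n].
  have XE : X = \pi_(tensor A A^c) t by rewrite pi_sum big_map.
  have t1 : normalized (\pi_(tensor A A^c) t).
    by rewrite /normalized op_mult_pi big_map.
  pose tt : seq ((A ⊗ conj_alg A) * (A ⊗ conj_alg A)^c)%type :=
    [seq (p.1 ⊗ tohat q.1, (p.2 : A) ⊗ tohat (q.2 : A)) | p <- t, q <- t].
  have XXE : XX = \pi_(tensor (A ⊗ conj_alg A)%type (A ⊗ conj_alg A)^c%type) tt.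
    rewrite pi_sum big_allpairs_dep big_map; apply: eq_bigr => i _.
    by rewrite big_map.
  have tt1 : normalized (\pi_(tensor (A ⊗ conj_alg A)%type (A ⊗ conj_alg A)^c%type) tt).
    (* The list [t] is reread in the conjugate algebra, whose product is that of [A]. *)
    have tc1 : normalized (\pi_(tensor (conj_alg A) (conj_alg A)^c%type) t).
      by rewrite /normalized op_mult_pi big_map.
    exact: normalized_tensor t1 tc1.
  have fl1 : fl D (eta_form X) =
      inner_fluctuation (tensor_rep pi J Jinv) D (eta_form XX).
    rewrite DE XE XXE (inner_fluctuation_eta Vsub Hrho dlin tt1).
    rewrite /fl (fluct_eta Vsub Hpi Hhat dlin t1).
    apply: eq_restrict => x Vx.
    (* The [hat] index is outermost in the double sandwich but second in A ⊗ hat A. *)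
    rewrite /sandwich big_allpairs_dep exchange_big /=; apply: eq_bigr => p _.
    rewrite (repr_sum Hhat); apply: eq_bigr => q _.
    rewrite !(tensor_rep_pure Hpi Hhat).
    by rewrite !(pi_hatC HD).
  split=> //; rewrite fl1 {1}DE XXE (inner_fluctuation_eta Vsub Hrho dlin tt1).
  have opE c c' : op c ** hat c' = total_op (tensor_rep pi J Jinv (c ⊗ tohat c')).
    by apply: funext => x; rewrite /total_op (tensor_rep_pure Hpi Hhat).
  rewrite [in RHS]DE.
  under [in RHS]eq_bigr do under eq_bigr do rewrite !opE.
  under [in RHS]eq_bigr do under eq_bigr do rewrite (repr_restrict_comm _ _ _ Hrho).
  rewrite restrict_sum2; apply: eq_restrict => x Vx.
  (* The explicit formula gives the same sandwich, now from the presentation by [a] and [b]. *)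
  rewrite -(sum_commutator Hrho _ _ tt1) big_allpairs_dep big_map.
  by congr (_ + _); apply: eq_bigr => i _; rewrite big_map.
elim/tensorW: X => t; elim/tensorW: X' => s t1 s1.
have st1 := normalizedM s1 t1.
rewrite tensor_mul_pi in st1 *; rewrite DE /fl.
(* The first fluctuation is again the restriction of a map linear on [V], so the formula applies to
   it in turn. *)
rewrite !(fluct_eta Vsub Hpi Hhat)//; last first.
  exact/(sandwich_linear_on Hhat)/(sandwich_linear_on Hpi).
apply: eq_restrict => x Vx.
exact: (sandwich_comp Hpi Hhat (pi_hatC HD)).
Qed.
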